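(* Let $m\ge 2$. Let $Q$ be a nondegenerate quadratic form on $V=\mathbb{F}_3^{2m+1}$ with polar form $B(x,y)=Q(x+y)-Q(x)-Q(y)$. Let $\mathrm{NO}^+_{2m+1}(3)$ be the graph whose vertices are the $1$-dimensional subspaces $\langle x\rangle$ with $Q(x)\neq 0$ such that the restriction of $Q$ to $x^{\perp}=\{y: B(x,y)=0\}$ is of plus (hyperbolic) type, two distinct vertices $\langle x\rangle,\langle y\rangle$ being adjacent if $B(x,y)\neq 0$. Then $\mathrm{NO}^+_{2m+1}(3)$ is non-separating if and only if $m=2$.
   Context: A graph $\Gamma$ is separating if $\omega(\Gamma)\alpha(\Gamma)<|V(\Gamma)|$, where $\omega$ and $\alpha$ are the maximum clique and coclique sizes; non-separating otherwise. (This property is unchanged on passing to the complementary graph.) The graph has $\frac12 3^m(3^m+1)$ vertices. *)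

(* Defs.v *)
From HB Require Import structures.
From mathcomp Require Import all_boot all_order all_algebra.

Set Implicit Arguments.
Unset Strict Implicit.
Unset Printing Implicit Defensive.

Import GRing.Theory.

Record sgraph := SGraph {
  vertex : finType;
  adj : rel vertex;
  adj_sym : symmetric adj;
  adj_irr : irreflexive adj }.

Definition clique (G : sgraph) (A : {set vertex G}) : bool :=
  [forall x in A, forall y in A, (x != y) ==> adj x y].

Definition coclique (G : sgraph) (A : {set vertex G}) : bool :=
  [forall x in A, forall y in A, ~~ adj x y].

Definition clique_number (G : sgraph) : nat :=
  \max_(A : {set vertex G} | clique A) #|A|.

Definition coclique_number (G : sgraph) : nat :=
  \max_(A : {set vertex G} | coclique A) #|A|.

Definition separating (G : sgraph) : bool :=
  clique_number G * coclique_number G < #|vertex G|.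

Local Open Scope ring_scope.

(* A subspace of 'rV['F_3]_n is given by a square matrix U as its row space,
   with x <= U in the scope %MS for membership; its canonical representative
   is <<U>>%MS. *)
Section QuadraticForms.

Variable n : nat.
Local Notation V := 'rV['F_3]_n.
Implicit Types (Q : V -> 'F_3) (x y : V) (U W : 'M['F_3]_n).

Definition polar Q x y : 'F_3 := Q (x + y) - Q x - Q y.

(* The polar form is symmetric, so linearity in one argument suffices. *)
Definition quadratic_form Q : Prop :=
  (forall (a : 'F_3) x, Q (a *: x) = a ^+ 2 * Q x)
  /\ (forall x, scalar (polar Q x)).

(* In odd characteristic, Q is nondegenerate on U iff its polar form is. *)
Definition nondegenerate_on Q U : bool :=
  [forall x : V, (x <= U)%MS ==>
    [forall y : V, (y <= U)%MS ==> (polar Q x y == 0)] ==> (x == 0)].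

Definition quad_nondegenerate Q : bool := nondegenerate_on Q 1%:M.

Definition totally_singular Q W : bool :=
  [forall x : V, (x <= W)%MS ==> (Q x == 0)].

Definition witt_index Q U : nat :=
  \max_(W : 'M['F_3]_n | (W <= U)%MS && totally_singular Q W) \rank W.

Definition plus_type Q U : bool :=
  nondegenerate_on Q U && (\rank U == 2 * witt_index Q U)%N.

(* For Q quadratic, { y | B(x,y) = 0 } is already a subspace, so taking its
   span adds nothing: see mem_perp. *)
Definition perp Q x : 'M['F_3]_n := (\sum_(y : V | polar Q x y == 0%R) <<y>>)%MS.

Lemma mem_perp Q x y :
  quadratic_form Q -> (y <= perp Q x)%MS = (polar Q x y == 0).
Proof.
move=> [_ /(_ x) Blin].
pose f : {scalar V} := HB.pack (polar Q x) (GRing.isLinear.Build _ _ _ _ _ Blin).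
have fE z : polar Q x z = f z by [].
apply/idP/eqP => [/sub_sumsmxP [u ->]|Bxy0]; last first.
  by apply: (sumsmx_sup y); rewrite ?Bxy0 // genmxE.
rewrite fE linear_sum big1 // => z /eqP Bxz0.
have /sub_rVP [a ->] : (u z *m <<z>> <= z)%MS.
  by apply: submx_trans (submxMl _ _) _; rewrite genmxE.
by rewrite linearZ /= [polar Q x z]Bxz0 mulr0.
Qed.

Definition NOplus_point Q U : bool :=
  [exists x : V, [&& U == <<x>>%MS, Q x != 0 & plus_type Q (perp Q x)]].

Definition NOplus_vertex Q : finType := {U : 'M['F_3]_n | NOplus_point Q U}.

Definition NOplus_adj Q : rel (NOplus_vertex Q) := fun X Y =>
  (X != Y) && [exists x : V, exists y : V,
    [&& (x <= val X)%MS, (y <= val Y)%MS & polar Q x y != 0]].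

Lemma NOplus_adj_sym Q : symmetric (@NOplus_adj Q).
Proof.
have adjS X Y : @NOplus_adj Q X Y -> @NOplus_adj Q Y X.
  case/andP=> XY /existsP [x] /existsP [y] /and3P [xX yY Bxy].
  rewrite /NOplus_adj eq_sym XY; apply/existsP; exists y; apply/existsP.
  by exists x; rewrite yY xX /polar [y + x]addrC addrAC.
by move=> X Y; apply/idP/idP; apply: adjS.
Qed.

Lemma NOplus_adj_irr Q : irreflexive (@NOplus_adj Q).
Proof. by move=> X; rewrite /NOplus_adj eqxx. Qed.

Definition NOplus Q : sgraph :=
  SGraph (@NOplus_adj_sym Q) (@NOplus_adj_irr Q).

Lemma NOplus_adjE Q x y (X Y : vertex (NOplus Q)) :
    quadratic_form Q -> val X = <<x>>%MS -> val Y = <<y>>%MS ->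
  adj X Y = (X != Y) && (polar Q x y != 0).
Proof.
move=> [_ Blin] Xx Yy; rewrite /= /NOplus_adj; congr (_ && _).
have BC u v : polar Q u v = polar Q v u by rewrite /polar [u + v]addrC addrAC.
have B0 u : polar Q u 0 = 0.
  have := Blin u (-1) 0 0; rewrite scaler0 addr0 mulN1r addrC.
  by move/eqP; rewrite subrr => /eqP.
have BZ u a v : polar Q u (a *: v) = a * polar Q u v.
  by have := Blin u a v 0; rewrite addr0 B0 addr0.
rewrite Xx Yy; apply/existsP/idP => [[u /existsP [v]]|Bxy]; last first.
  by exists x; apply/existsP; exists y; rewrite !genmxE !submx_refl.
rewrite !genmxE => /and3P [/sub_rVP [a ->] /sub_rVP [b ->]].
by rewrite BZ BC BZ BC; apply: contraNN => /eqP ->; rewrite !mulr0.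
Qed.

End QuadraticForms.

(* Main.v *)
(** The vertices are the points <x> with Q x = e for a fixed value e, and a
    maximal totally singular W inside x^perp has dimension m. Off W^perp, every
    coset of W meets all values of Q equally often; this counts the vertices,
    the vertices orthogonal to a given one, and those orthogonal to two
    nonorthogonal ones. The resulting variance bound (the Hoffman bound of the
    strongly regular graph) gives omega <= 3^m, attained by the points <x + w>
    for w in W. A coclique is an orthogonal frame, so alpha <= 2m+1, and
    3^m (2m+1) < 3^m (3^m+1)/2 as soon as m >= 3. For m = 2, x^perp is the
    sum of two hyperbolic planes, which yields a frame of 5 vertices, and
    9 * 5 = 45. *)

From HB Require Import structures.
Require Import Defs.
From mathcomp Require Import all_boot all_order all_algebra.
From mathcomp Require Import mxabelem zify ring.

Set Implicit Arguments.
Unset Strict Implicit.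
Unset Printing Implicit Defensive.

Import GRing.Theory.

(** * Elementary inequalities for the variance argument *)

Section Counting.

Lemma sum_bool_card (I : finType) (A : {set I}) (b : pred I) :
  \sum_(i in A) b i = #|[set i in A | b i]|.
Proof.
rewrite -sum1_card; under [RHS]eq_bigl do rewrite inE.
by rewrite big_mkcondr; apply: eq_bigr => i _; case: (b i).
Qed.

(** Cauchy-Schwarz against the constant function 1. Both sides are doubled so that the claim becomes
    [2ab <= a^2 + b^2] for each pair of indices. *)
Lemma leq_sqr_sum (I : finType) (A : {set I}) (f : I -> nat) :
  (\sum_(i in A) f i) ^ 2 <= #|A| * \sum_(i in A) f i ^ 2.
Proof.
rewrite -(leq_pmul2l (m := 2)) // -mulnn big_distrlr /= big_distrr /=.
have -> : 2 * (#|A| * \sum_(i in A) f i ^ 2) =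
    \sum_(i in A) \sum_(j in A) (f i ^ 2 + f j ^ 2).
  under [RHS]eq_bigr do rewrite big_split /= sum_nat_const.
  by rewrite big_split /= sum_nat_const -big_distrr /=; lia.
apply: leq_sum => i _; rewrite big_distrr /=; apply: leq_sum => j _.
exact: nat_Cauchy.
Qed.

(* The last hypothesis amounts to [(q - 1) w^2 + 4 q w <= 9 q^3 + 3 q^2], an
   equality at [w = 3 q]. *)
Lemma clique_arith q w k l : 0 < q ->
  l * 3 = 3 * q * q - 3 * q -> k * 3 = 3 * q * (3 * q) - 3 * q ->
  2 * w <= 3 * q * (3 * q + 1) ->
  (w * k) ^ 2 <= (3 * q * (3 * q + 1) - 2 * w) * (w * (k + (w - 1) * l)) ->
  w <= 3 * q.
Proof.
move=> q0 lE kE; have {lE} -> : l = q * (q - 1) by nia.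
have {kE} -> : k = q * (3 * q - 1) by nia.
case: q q0 => // q _ wle; have dE := subnK wle; move: (_ - 2 * w) dE => d dE le.
rewrite leqNgt; apply/negP => lt_w.
(* After [q] is replaced by its successor the bound reads [3 q + 3], so [t] is the excess of [w]
   over the least violating value. *)
have [t wE] : exists t, w = 3 * q + 4 + t by exists (w - (3 * q + 4)); lia.
(* Both sides of the quadratic inequality share the factor [q.+1 * w], which is cancelled. *)
have {le} : w * q.+1 * (3 * q + 2) ^ 2 <= d * (3 * q + 2 + (w - 1) * q).
  rewrite -(leq_pmul2l (m := q.+1 * w)) ?muln_gt0; last by rewrite wE addn4.
  have -> : q.+1 * w * (w * q.+1 * (3 * q + 2) ^ 2) =
    (w * (q.+1 * (3 * q.+1 - 1))) ^ 2.
    by rewrite (_ : 3 * q.+1 - 1 = 3 * q + 2); [ring | lia].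
  apply: (leq_trans le); apply: eq_leq.
  by rewrite (_ : 3 * q.+1 - 1 = 3 * q + 2) ?subn1 /=; [ring | lia].
rewrite leqNgt => /negP; apply.
have -> : w - 1 = 3 * q + 3 + t by lia.
have {}dE : d + 2 * t = 9 * q ^ 2 + 15 * q + 4 by rewrite wE in dE; nia.
rewrite wE.
nia.
Qed.

End Counting.

(* A copy of [polar] over a general finite field: unification at the concrete
   type ['F_3] is prohibitively slow, so the linear algebra is done over an
   abstract field with three elements. *)
Definition bil (F : finFieldType) n (Q : 'rV[F]_n -> F) x y : F :=
  (Q (x + y) - Q x - Q y)%R.

Definition gram (F : finFieldType) n (Q : 'rV[F]_n -> F) : 'M_n :=
  (\matrix_(i, j) bil Q (delta_mx 0 i) (delta_mx 0 j))%R.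

(** The orthogonal complement of the row space of [A]: [x] lies in it when [x] times the Gram matrix
    times the transpose of [A] vanishes. *)
HB.lock Definition orthm (F : finFieldType) n (Q : 'rV[F]_n -> F) k
  (A : 'M_(k, n)) : 'M_n := kermx (gram Q *m A^T)%R.

(** * Quadratic forms over a field with three elements *)

Section OverF3.

Local Open Scope ring_scope.

Variable F : finFieldType.
Hypothesis F3_cases : forall a : F, [\/ a = 0, a = 1 | a = -1].
Hypothesis F3_two : 1 + 1 = -1 :> F.

Lemma F3_neq1 : (-1 == 1 :> F) = false.
Proof.
apply/eqP => F11; have /eqP := F3_two; rewrite F11 -subr_eq0 addrK.
exact/negP/oner_neq0.
Qed.

Lemma F3_sqr (a : F) : a != 0 -> a * a = 1.
Proof. by case: (F3_cases a) => ->; rewrite ?eqxx ?mulrNN ?mulr1. Qed.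

Lemma F3_addrr (a : F) : a + a = - a.
Proof. by rewrite -[in LHS](mulr1 a) -mulrDr F3_two mulrN1. Qed.

Lemma F3_eq_opp (a b : F) : a != 0 -> b != 0 -> a != b -> b = - a.
Proof.
by case: (F3_cases a) => ->; case: (F3_cases b) => ->; rewrite ?eqxx ?opprK.
Qed.

Lemma F3_addrr_eq0 (a : F) : (a + a == 0) = (a == 0).
Proof. by rewrite F3_addrr oppr_eq0. Qed.

Variables (n : nat) (Q : 'rV[F]_n -> F).

Hypothesis QZ : forall a x, Q (a *: x) = a ^+ 2 * Q x.
Hypothesis Blin : forall x, scalar (bil Q x).
Local Notation B := (bil Q).
Local Notation gram := (gram Q).
Local Notation orthm := (orthm Q).
Implicit Types (x y z u v w : 'rV[F]_n) (a c : F).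

Lemma bilC x y : B x y = B y x.
Proof. by rewrite /bil [x + y]addrC addrAC. Qed.

Lemma bil0r x : B x 0 = 0.
Proof.
have := Blin x (-1) 0 0; rewrite scaler0 addr0 mulN1r addrC.
by move/eqP; rewrite subrr => /eqP.
Qed.

Lemma bilZr a x y : B x (a *: y) = a * B x y.
Proof.
by have := Blin x a y 0; rewrite addr0 bil0r addr0.
Qed.

Lemma bilDr x y z : B x (y + z) = B x y + B x z.
Proof. by have := Blin x 1 y z; rewrite scale1r mul1r. Qed.

Lemma bilNr x y : B x (- y) = - B x y.
Proof. by rewrite -scaleN1r bilZr mulN1r. Qed.

Lemma bil0l x : B 0 x = 0. Proof. by rewrite bilC bil0r. Qed.
Lemma bilZl a x y : B (a *: x) y = a * B x y.
Proof. by rewrite bilC bilZr bilC. Qed.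
Lemma bilDl x y z : B (x + y) z = B x z + B y z.
Proof. by rewrite bilC bilDr !(bilC z). Qed.
Lemma bilNl x y : B (- x) y = - B x y.
Proof. by rewrite bilC bilNr bilC. Qed.

Lemma quadZ a x : Q (a *: x) = a * a * Q x.
Proof. by rewrite QZ expr2. Qed.

Lemma quad0 : Q 0 = 0.
Proof. by rewrite -(scale0r (0 : 'rV_n)) quadZ !mul0r. Qed.

Lemma quadN x : Q (- x) = Q x.
Proof. by rewrite -scaleN1r quadZ mulrNN !mul1r. Qed.

Lemma quadD x y : Q (x + y) = Q x + Q y + B x y.
Proof. rewrite /bil; ring. Qed.

(** In general [B x x = 2 Q x], and [2 = -1] here; thus a vector is orthogonal to itself exactly
    when it is singular. *)
Lemma bilxx x : B x x = - Q x.
Proof.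
by rewrite /bil -[x]scale1r -scalerDl F3_two scaleN1r scale1r quadN -addrA
  -opprD F3_addrr opprK F3_addrr.
Qed.

Lemma quadB x y : Q (x - y) = Q x + Q y - B x y.
Proof. by rewrite quadD quadN bilNr. Qed.

Lemma bil_suml (I : finType) (f : I -> 'rV_n) y :
  B (\sum_i f i) y = \sum_i B (f i) y.
Proof.
by elim/big_rec2: _ => [|i a x _ IH]; rewrite ?bil0l // bilDl IH.
Qed.

(** * Gram matrix, orthogonal complements and totally singular subspaces *)

Lemma bil_gram x y : x *m gram *m y^T = (B x y)%:M.
Proof.
apply/rowP => j; rewrite !ord1 [RHS]mxE eqxx mulr1n [in RHS](row_sum_delta y)
  mxE.
rewrite bilC bil_suml; apply: eq_bigr => k _.
rewrite bilZl [in RHS](row_sum_delta x) bilC bil_suml !mxE mulrC; congr (_ * _).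
by apply: eq_bigr => i _; rewrite bilZl !mxE.
Qed.

Lemma bil_eq0 x y : (B x y == 0) = (x *m gram *m y^T == 0).
Proof.
rewrite bil_gram; apply/eqP/eqP => [->|]; first exact: raddf0.
by move/matrixP/(_ 0 0); rewrite !mxE eqxx.
Qed.

Lemma orthmP k (A : 'M_(k, n)) x :
  reflect (forall y, (y <= A)%MS -> B x y = 0) (x <= orthm A)%MS.
Proof.
rewrite orthm.unlock; apply: (iffP sub_kermxP) => [xA y /submxP [d ->]|xA].
  by apply/eqP; rewrite bil_eq0 trmx_mul !mulmxA -(mulmxA x) xA mul0mx.
apply/rowP => i; rewrite mulmxA.
have := xA _ (row_sub i A) => /eqP; rewrite bil_eq0 => /eqP/matrixP/(_ 0 0).
rewrite !mxE => xi0; rewrite -[RHS]xi0; apply: eq_bigr => j _.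
by rewrite !mxE.
Qed.

Lemma orthmC j k (A : 'M_(j, n)) (C : 'M_(k, n)) :
  (A <= orthm C)%MS = (C <= orthm A)%MS.
Proof.
have impl i l (A' : 'M_(i, n)) (C' : 'M_(l, n)) :
  (A' <= orthm C')%MS -> (C' <= orthm A')%MS.
  move=> sAC; apply/rV_subP => v vC; apply/orthmP => y yA.
  by rewrite bilC; move/orthmP: (submx_trans yA sAC) => ->.
by apply/idP/idP; apply: impl.
Qed.

Lemma orthm_rV x y : (x <= orthm y)%MS = (B x y == 0).
Proof.
apply/orthmP/eqP => [-> // | Bxy z /sub_rVP [a ->]].
by rewrite bilZr Bxy mulr0.
Qed.

Lemma orthm_adds j k (A : 'M_(j, n)) (C : 'M_(k, n)) x :
  (x <= orthm (A + C)%MS)%MS = (x <= orthm A)%MS && (x <= orthm C)%MS.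
Proof. by rewrite orthmC addsmx_sub (orthmC A) (orthmC C). Qed.

(* Totally singular. *)
Definition ts k (W : 'M[F]_(k, n)) := forall x, (x <= W)%MS -> Q x = 0.

Lemma ts_orthm k (W : 'M_(k, n)) : ts W -> (W <= orthm W)%MS.
Proof.
move=> tsW; apply/rV_subP => x xW; apply/orthmP => y yW.
by rewrite /bil !tsW ?subr0 // addmx_sub.
Qed.

Lemma ts_adds j k (A : 'M_(j, n)) (C : 'M_(k, n)) :
  ts A -> ts C -> (A <= orthm C)%MS -> ts (A + C)%MS.
Proof.
move=> tsA tsC sAC z /sub_addsmxP [[u v] /= ->].
rewrite quadD tsA ?tsC ?submxMl // !add0r.
by move/orthmP: (submx_trans (submxMl u A) sAC); apply; apply: submxMl.
Qed.

Lemma ts_rV x : Q x = 0 -> ts x.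
Proof. by move=> Qx y /sub_rVP [a ->]; rewrite quadZ Qx mulr0. Qed.

Lemma ts_sub j k (A : 'M_(j, n)) (C : 'M_(k, n)) : ts C -> (A <= C)%MS -> ts A.
Proof. by move=> tsC sAC x xA; apply: tsC; apply: submx_trans sAC. Qed.

(** * Nondegenerate forms: dimensions of complements, existence of totally singular subspaces *)

Hypothesis Qnd : forall x, (forall y, B x y = 0) -> x = 0.

Lemma gram_unit : gram \in unitmx.
Proof.
rewrite -row_free_unit -kermx_eq0; apply/rowV0P => x /sub_kermxP xG.
by apply: Qnd => y; apply/eqP; rewrite bil_eq0 xG mul0mx.
Qed.

Lemma rank_orthm k (A : 'M_(k, n)) : \rank (orthm A) = (n - \rank A)%N.
Proof.
by rewrite orthm.unlock mxrank_ker eqmxMfull ?mxrank_tr // row_full_unit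
  gram_unit.
Qed.

Lemma orthmK k (A : 'M_(k, n)) : (orthm (orthm A) :=: A)%MS.
Proof.
apply/eqmx_sym/eqmxP; have AA : (A <= orthm (orthm A))%MS by rewrite -orthmC.
rewrite AA /=; have := mxrank_leqif_sup AA; rewrite !rank_orthm.
by move/geq_leqif => <-; have := rank_leq_col A; lia.
Qed.

Lemma rank_ts k (W : 'M_(k, n)) : ts W -> (2 * \rank W <= n)%N.
Proof.
by move/ts_orthm/mxrankS; rewrite rank_orthm; have := rank_leq_col W; lia.
Qed.

Lemma rank_adds_rV k (W : 'M_(k, n)) x :
  ~~ (x <= W)%MS -> \rank (W + x)%MS = (\rank W).+1.
Proof.
move=> xW; have x0 : x != 0 by apply: contraNneq xW => ->; apply: sub0mx.
have := mxrank_sum_cap W x; rewrite rank_rV x0.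
suff -> : \rank (W :&: x)%MS = 0%N by lia.
apply/eqP; rewrite mxrank_eq0; apply/rowV0P => y; rewrite sub_capmx =>
  /andP [yW /sub_rVP [a yE]].
case: (eqVneq a 0) => [a0|a0]; first by rewrite yE a0 scale0r.
by case/negP: xW; rewrite -(scale1r x) -(mulVf a0) -scalerA -yE scalemx_sub.
Qed.

Lemma rank_adds_le k (W : 'M_(k, n)) x : (\rank (W + x)%MS <= (\rank W).+1)%N.
Proof.
by case: (boolP (x <= W)%MS) => [/addsmx_idPl -> // | /rank_adds_rV ->].
Qed.

Lemma not_submx_exists j k (A : 'M[F]_(j, n)) (C : 'M[F]_(k, n)) :
  ~~ (A <= C)%MS -> exists2 x : 'rV_n, (x <= A)%MS & ~~ (x <= C)%MS.
Proof. by case/row_subPn => i Ci; exists (row i A) => //; apply: row_sub. Qed.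

Lemma rank_lt_exists j k (A : 'M[F]_(j, n)) (C : 'M[F]_(k, n)) :
  (\rank C < \rank A)%N -> exists2 x : 'rV_n, (x <= A)%MS & ~~ (x <= C)%MS.
Proof.
by move=> lt_r; apply: not_submx_exists; apply: contraTN lt_r => /mxrankS; lia.
Qed.

(* Among three mutually orthogonal vectors of [orthm W] off [W] one is singular,
   or two have opposite values, or all values agree and the sum is singular. *)
Lemma ts_extend (W : 'M_n) : ts W -> (2 * \rank W + 3 <= n)%N ->
  exists W' : 'M_n, ts W' /\ \rank W' = (\rank W).+1.
Proof.
move=> tsW rW.
suff [v vW [vnW Qv]] : exists2 v, (v <= orthm W)%MS & ~~ (v <= W)%MS /\ Q v = 0.
  exists (W + v)%MS; split; last exact: rank_adds_rV.
  by apply: ts_adds => //; [apply: ts_rV | rewrite orthmC].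
have next (U : 'M_n) : (\rank U <= \rank W + 2)%N ->
  exists2 x : 'rV_n, (x <= orthm U)%MS & ~~ (x <= W)%MS.
- by move=> rU; apply: rank_lt_exists; rewrite rank_orthm; lia.
have [a aW anW] := next W ltac:(lia).
have [b] := next (W + a)%MS ltac:(have := rank_adds_le W a; lia).
rewrite orthm_adds orthm_rV => /andP [bW /eqP Bba] bnW.
have [c] := next (W + a + b)%MS
  ltac:(have := rank_adds_le W a; have := rank_adds_le (W + a)%MS b; lia).
rewrite !orthm_adds !orthm_rV => /andP [/andP [cW /eqP Bca] /eqP Bcb] cnW.
have [Qa|Qa] := eqVneq (Q a) 0; first by exists a.
have [Qb|Qb] := eqVneq (Q b) 0; first by exists b.
have [Qc|Qc] := eqVneq (Q c) 0; first by exists c.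
have notW v : B v a = - Q a -> ~~ (v <= W)%MS.
  move=> Bva; apply: contra Qa => vW; rewrite -oppr_eq0 -Bva bilC.
  by move/orthmP: aW => ->.
have abnW : ~~ ((a + b)%R <= W)%MS by rewrite notW // bilDl Bba addr0 bilxx.
have acnW : ~~ ((a + c)%R <= W)%MS by rewrite notW // bilDl Bca addr0 bilxx.
have abcnW : ~~ ((a + b + c)%R <= W)%MS.
  by rewrite notW // !bilDl Bba Bca !addr0 bilxx.
have [Qab|Qab] := eqVneq (Q a) (Q b); last first.
  exists (a + b); [exact: addmx_sub | split=> //].
  by rewrite quadD bilC Bba addr0 (F3_eq_opp Qa Qb Qab) subrr.
have [Qac|Qac] := eqVneq (Q a) (Q c); last first.
  exists (a + c); [exact: addmx_sub | split=> //].
  by rewrite quadD bilC Bca addr0 (F3_eq_opp Qa Qc Qac) subrr.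
exists (a + b + c); [by rewrite !addmx_sub | split=> //].
rewrite !quadD bilDl !(bilC _ c) Bca Bcb (bilC a) Bba !addr0 -Qab -Qac.
by rewrite F3_addrr addNr.
Qed.

Lemma ts_max_exists (m : nat) : (2 * m + 1 <= n)%N ->
  exists W : 'M_n, ts W /\ \rank W = m.
Proof.
elim: m => [|m IH] le_mn.
  by exists 0; split; [move=> x; rewrite submx0 => /eqP ->;
    apply: quad0 | apply: mxrank0].
have [W [tsW rW]] := IH ltac:(lia).
by have [|W' [tsW' rW']] := ts_extend tsW; [lia | exists W'; rewrite rW' rW].
Qed.

(** * Equidistribution of the values of [Q] off the complement of a totally singular subspace *)

Lemma card_F3 : #|F| = 3%N.
Proof.
rewrite -cardsT; have -> : [set: F] = [set 0; 1; -1].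
  by apply/setP => a; rewrite !inE; case: (F3_cases a) => ->;
    rewrite eqxx ?orbT.
by rewrite setUC cardsU1 cards2 !inE oppr_eq0 F3_neq1 [0 == 1]eq_sym !oner_eq0.
Qed.

Definition level (P : 'M[F]_n) (c : F) :=
  [set y : 'rV_n | (y <= P)%MS & Q y == c].

(* The injection is [y |-> y + w] with [w] in [W] and [B y w = 1], where [w] is
   chosen from the functional [B y] on [W], which [y] and [y + w] share. *)
Lemma leq_card_level_shift (P W : 'M_n) c : ts W -> (W <= P)%MS ->
  (#|level P c :\: rowg (orthm W)| <=
     #|level P (c + 1)%R :\: rowg (orthm W)|)%N.
Proof.
move=> tsW WP; pose w0 y := [pick w : 'rV_n | (w <= W)%MS & B y w == 1].
pose f y := if w0 y is Some w then y + w else y.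
have BW (w w' : 'rV_n) : (w <= W)%MS -> (w' <= W)%MS -> B w w' = 0.
  by move=> wW w'W; move/orthmP: (submx_trans wW (ts_orthm tsW)) => ->.
have fP y : y \notin rowg (orthm W) ->
  exists w : 'rV_n, [/\ f y = y + w, w0 y = Some w, (w <= W)%MS & B y w = 1].
- rewrite inE => ynW; rewrite /f /w0; case: pickP => [w /andP [wW /eqP yw]|noW].
    by exists w.
  case/negP: ynW; apply/orthmP => w wW; apply/eqP/negPn/negP => yw.
  by have := noW (B y w *: w); rewrite scalemx_sub // bilZr F3_sqr // eqxx.
have f_inj : {in level P c :\: rowg (orthm W) &, injective f}.
  move=> y y' /setDP [_ /fP [w [-> yw wW _]]] /setDP [_ /fP [w' [-> yw' w'W
    _]]] yy'.
  have : w0 y = w0 y'.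
    apply: eq_pick => v /=; case: (boolP (v <= W)%MS) => //= vW.
    have : B (y + w) v = B (y' + w') v by rewrite yy'.
    by rewrite !bilDl (BW _ _ wW vW) (BW _ _ w'W vW) !addr0 => ->.
  by rewrite yw yw' => -[ww']; move: yy'; rewrite ww' => /addIr.
rewrite -(card_in_imset f_inj); apply/subset_leq_card/subsetP => z /imsetP [y].
case/setDP; rewrite inE => /andP [yP /eqP Qy] ynW ->.
have [w [-> _ wW yw]] := fP _ ynW.
rewrite !inE quadD Qy tsW // addr0 yw eqxx andbT; apply/andP; split.
  move: ynW; rewrite inE; apply: contra => ywW; rewrite -(addrK w y).
  by rewrite addmx_sub // eqmx_opp (submx_trans wW) // ts_orthm.
by rewrite addmx_sub // (submx_trans wW).
Qed.

(** Shifting by 1 runs through the cycle 0, 1, -1, 0, so the three inequalities between level sizes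
    are equalities, and each level holds a third of [P] minus the complement of [W]. *)
Lemma card_level_off_orth (P W : 'M_n) c : ts W -> (W <= P)%MS ->
  (#|level P c :\: rowg (orthm W)| * 3 =
    3 ^ \rank P - 3 ^ \rank (P :&: orthm W))%N.
Proof.
move=> tsW WP; set D := fun c => #|level P c :\: rowg (orthm W)|.
have shift d : (D d <= D (d + 1)%R)%N by apply: leq_card_level_shift.
have Dconst d : D d = D 0.
  have := shift 0; have := shift 1; have := shift (-1).
  rewrite addNr F3_two add0r.
  by case: (F3_cases d) => ->; move: (D 0) (D 1) (D (-1)) => d0 d1 d2; lia.
rewrite -card_F3 -!card_rowg -[LHS]mulnC -sum_nat_const.
have <- : rowg P :&: rowg (orthm W) = rowg (P :&: orthm W)%MS.
  by apply/setP => y; rewrite !inE sub_capmx.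
rewrite -cardsD -[RHS]sum1_card (partition_big Q xpredT) //=.
apply: eq_bigr => d _; rewrite -/(D c) Dconst -(Dconst d) /D -sum1_card.
by apply: eq_bigl => y; rewrite !inE andbA.
Qed.

(** * Counting with a maximal totally singular subspace orthogonal to [x] *)

Variable m : nat.
Hypothesis n_odd : n = (2 * m + 1)%N.

(** Otherwise [W + y] would be totally singular of dimension [m + 1], more than half of [n]. *)
Lemma ts_orth_singular (W : 'M_n) y :
  ts W -> \rank W = m -> (y <= orthm W)%MS -> Q y = 0 -> (y <= W)%MS.
Proof.
move=> tsW rW yW Qy; apply/negPn/negP => ynW.
have : ts (W + y)%MS by apply: ts_adds; rewrite // 1?orthmC //; apply: ts_rV.
by move/rank_ts; rewrite rank_adds_rV // rW; lia.
Qed.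

(* By [plus_typeP], for [Q x != 0] this says that [x]^perp is of plus type. *)
Definition plus_vector x :=
  exists W : 'M[F]_n, [/\ ts W, \rank W = m & (W <= orthm x)%MS].

Lemma plus_vector_exists : exists2 x, Q x != 0 & plus_vector x.
Proof.
have [W [tsW rW]] := ts_max_exists (m := m) ltac:(lia).
have [x xW xnW] : exists2 x : 'rV_n, (x <= orthm W)%MS & ~~ (x <= W)%MS.
  by apply: rank_lt_exists; rewrite rank_orthm rW; lia.
exists x; last by exists W; split; rewrite // orthmC.
by apply: contra xnW => /eqP; apply: ts_orth_singular.
Qed.

Section PlusVector.

Variables (x : 'rV[F]_n) (W : 'M[F]_n).
Hypotheses (Qx : Q x != 0) (tsW : ts W) (rW : \rank W = m).
Hypothesis Wx : (W <= orthm x)%MS.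

(** The complement of [W] has dimension [m + 1]; it contains [W + x], which has the same dimension
    because [x] is nonsingular and so lies off [W]. *)
Lemma orth_ts_decomp y : (y <= orthm W)%MS ->
  exists2 w, (w <= W)%MS & exists a, y = w + a *: x.
Proof.
have xnW : ~~ (x <= W)%MS by apply: contra Qx => /tsW ->.
have WxW : (W + x <= orthm W)%MS by rewrite addsmx_sub ts_orthm // orthmC.
have : (orthm W <= W + x)%MS.
  rewrite -(geq_leqif (mxrank_leqif_sup WxW)) rank_adds_rV // rank_orthm rW;
    lia.
move=> sW yW; have /sub_addsmxP [[u v] /= yE] := submx_trans yW sW.
have /sub_rVP [a vE] := submxMl v x.
by exists (u *m W); [apply: submxMl | exists a; rewrite yE vE].
Qed.

Lemma orth_ts_perp y : (y <= orthm W)%MS -> (y <= orthm x)%MS -> (y <= W)%MS.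
Proof.
move=> yW; rewrite orthm_rV; have [w wW [a ->]] := orth_ts_decomp yW.
have /orthmP/(_ x (submx_refl _)) wx := submx_trans wW Wx.
rewrite bilDl wx add0r bilZl bilxx mulf_eq0 oppr_eq0 (negbTE Qx) orbF =>
  /eqP ->.
by rewrite scale0r addr0.
Qed.

(** Inside [x]^perp the complement of [W] reduces to [W], where [Q] vanishes. Hence a level of
    nonzero value loses nothing when that complement is removed, and equidistribution applies. *)
Lemma card_level_perp (P : 'M_n) c :
  c != 0 -> (W <= P)%MS -> (P <= orthm x)%MS ->
  (#|level P c| * 3 = 3 ^ \rank P - 3 ^ m)%N.
Proof.
move=> c0 WP Px.
have PW : (P :&: orthm W :=: W)%MS.
  apply/eqmxP/rV_eqP => y; rewrite sub_capmx; apply/andP/idP => [[yP yW]|yW].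
    by apply: orth_ts_perp => //; apply: submx_trans Px.
  by rewrite !(submx_trans yW) // ts_orthm.
rewrite -rW -PW -(card_level_off_orth c) //; congr (#|pred_of_set _| * _)%N.
apply/esym/setDidPl; rewrite disjoints_subset; apply/subsetP => y; rewrite !inE.
case/andP => yP /eqP Qy; apply/negP => yW; case/negP: c0; rewrite -Qy tsW //.
by rewrite -PW sub_capmx yP.
Qed.

(** [Q (w + a *: x)] is [a ^+ 2 * Q x], so [Q] is constantly [Q x] on the complement of [W] outside
    [W], a set of size [3^(m+1) - 3^m]. *)
Lemma card_level_orth : #|level (orthm W) (Q x)| = (2 * 3 ^ m)%N.
Proof.
have -> : level (orthm W) (Q x) = rowg (orthm W) :\: rowg W.
  apply/setP => y; rewrite !inE andbC; case: (boolP (y <= orthm W)%MS);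
    rewrite ?andbF //= => yW.
  rewrite !andbT; apply/eqP/idP => [Qy|ynW].
    by apply: contra Qx => /tsW <-; rewrite Qy.
  have Qy : Q y != 0 by apply: contra ynW => /eqP; apply: ts_orth_singular.
  have [w wW [a yE]] := orth_ts_decomp yW.
  have /orthmP/(_ x (submx_refl _)) wx := submx_trans wW Wx.
  move: Qy; rewrite yE quadD bilZr wx mulr0 addr0 tsW // add0r quadZ.
  have [->|a0 _] := eqVneq a 0; first by rewrite !mul0r eqxx.
  by rewrite F3_sqr // mul1r.
rewrite cardsD (setIidPr _); last first.
  by apply/subsetP => y; rewrite !inE => yW;
    apply: submx_trans yW (ts_orthm tsW).
rewrite !card_rowg card_F3 rank_orthm rW.
have -> : (n - m = m.+1)%N by lia.
by rewrite expnS; lia.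
Qed.

Lemma card_level_split c :
  #|level 1%:M c| = (#|level (orthm W) c| + (3 ^ m * (3 ^ m - 1)))%N.
Proof.
rewrite -(cardsID (rowg (orthm W)) (level 1%:M c)); congr (_ + _)%N.
  by apply: eq_card => y; rewrite !inE submx1 andbC.
have := @card_level_off_orth 1%:M W c tsW (submx1 _).
rewrite cap1mx mxrank1 rank_orthm rW; move: #|_| => k; rewrite n_odd.
have -> : (2 * m + 1 - m = m.+1)%N by lia.
rewrite addn1 mul2n -addnn !expnS expnD.
by have := expn_gt0 3 m; nia.
Qed.

Lemma card_level_plus : #|level 1%:M (Q x)| = (3 ^ m * (3 ^ m + 1))%N.
Proof.
by rewrite card_level_split card_level_orth; have := expn_gt0 3 m; nia.
Qed.

(** On the complement of [W] only the values 0 and [Q x] occur, so all vectors of value [- Q x] lie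
    off it. *)
Lemma card_level_minus : #|level 1%:M (- Q x)%R| = (3 ^ m * (3 ^ m - 1))%N.
Proof.
rewrite card_level_split [X in (X + _)%N](_ : _ = 0%N) //.
apply: eq_card0 => y; rewrite !inE; apply/negP => /andP [yW /eqP Qy].
have [w wW [a yE]] := orth_ts_decomp yW.
have /orthmP/(_ x (submx_refl _)) wx := submx_trans wW Wx.
move/eqP: Qy; rewrite yE quadD bilZr wx mulr0 addr0 tsW // add0r quadZ.
have [->|a0] := eqVneq a 0; first by rewrite !mul0r eq_sym oppr_eq0 (negbTE Qx).
by rewrite F3_sqr // mul1r -subr_eq0 opprK F3_addrr_eq0 (negbTE Qx).
Qed.

(** Replace [W] by its part orthogonal to [r], of codimension at most 1, and add [r]. The dimension
    is then at least [m], and [rank_ts] excludes more. *)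
Lemma ts_through r : Q r = 0 -> (r <= orthm x)%MS ->
  exists W' : 'M_n, [/\ ts W', \rank W' = m, (W' <= orthm x)%MS & (r <= W')%MS].
Proof.
move=> Qr rx; have [rinW|rnW] := boolP (r <= W)%MS; first by exists W.
set W' := (W :&: orthm r + r)%MS.
have tsW' : ts W'.
  apply: ts_adds; [exact: ts_sub tsW (capmxSl _ _)|exact: ts_rV|exact: capmxSr].
exists W'; split=> //; last exact: addsmxSr.
  have := rank_ts tsW'; rewrite /W' rank_adds_rV; last first.
    by apply: contra rnW => /submx_trans; apply; apply: capmxSl.
  have := mxrank_sum_cap W (orthm r); have := rank_leq_col (W + orthm r)%MS.
  by have := rank_leq_row r; rewrite rank_orthm rW; lia.
by rewrite addsmx_sub rx (submx_trans (capmxSl _ _) Wx).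
Qed.

End PlusVector.

(** Two different nonzero values are opposite; then one and the same level would have both
    [3^m (3^m + 1)] and [3^m (3^m - 1)] elements. *)
Lemma plus_vector_quad x y :
  Q x != 0 -> plus_vector x -> Q y != 0 -> plus_vector y -> Q y = Q x.
Proof.
move=> Qx [W [tsW rW Wx]] Qy [W' [tsW' rW' Wy]].
apply/eqP/negPn/negP; rewrite eq_sym => /F3_eq_opp => /(_ Qx Qy) Qyx.
have := card_level_plus Qy tsW' rW' Wy;
  rewrite Qyx (card_level_minus Qx tsW rW Wx).
by have := expn_gt0 3 m; nia.
Qed.

(** * Reflections, and the independence of plus type from the chosen vector of given value *)

(** The usual factor [1 / Q z] is written [Q z], its own inverse when [z] is nonsingular. *)
Definition reflection z : 'M[F]_n := 1%:M - Q z *: (gram *m z^T *m z).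

Lemma reflectionE z y : y *m reflection z = y - (Q z * B y z) *: z.
Proof.
by rewrite mulmxBr mulmx1 -scalemxAr !mulmxA bil_gram mul_scalar_mx scalerA.
Qed.

Lemma reflection_quad z y : Q z != 0 -> Q (y *m reflection z) = Q y.
Proof.
move=> Qz; rewrite reflectionE quadB quadZ bilZr.
set b := B y z; have -> : Q z * b * (Q z * b) * Q z =
  (Q z * Q z) * (Q z * b * b) by ring.
by rewrite F3_sqr //; ring.
Qed.

Lemma reflectionK z y : Q z != 0 -> y *m reflection z *m reflection z = y.
Proof.
move=> Qz; rewrite !reflectionE bilDl bilNl bilZl bilxx.
have -> : Q z * (B y z - Q z * B y z * - Q z) =
  (Q z * B y z) * (1 + Q z * Q z) by ring.
by rewrite F3_sqr // F3_two mulrN1 scaleNr opprK subrK.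
Qed.

Lemma reflection_bil z u v : Q z != 0 ->
  B (u *m reflection z) (v *m reflection z) = B u v.
Proof. by move=> Qz; rewrite /bil -mulmxDl !reflection_quad. Qed.

(* One of [x - y] and [x + y] is anisotropic, and the reflection in it maps
   [x] to [y] or to [- y]. *)
Lemma plus_vector_transfer x y :
  Q x != 0 -> Q y = Q x -> plus_vector x -> plus_vector y.
Proof.
move=> Qx Qyx [W [tsW rW Wx]].
have tr z a : Q z != 0 -> a != 0 -> x *m reflection z = a *: y -> plus_vector y.
  move=> Qz a0 xz; exists (W *m reflection z); split.
  - move=> w /submxP [u ->].
    by rewrite mulmxA reflection_quad // tsW ?submxMl.
  - apply/eqP; rewrite eqn_leq -{1}rW mxrankM_maxl /= -rW.
    suff {1}-> : W = W *m reflection z *m reflection z by apply: mxrankM_maxl.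
    by apply/row_matrixP => i; rewrite !row_mul reflectionK.
  apply/rV_subP => w /submxP [u ->]; rewrite orthm_rV.
  have : B (u *m W) x = 0 by move/orthmP: (submx_trans (submxMl u W) Wx) => ->.
  rewrite -(reflection_bil _ _ Qz) xz bilZr mulmxA => /eqP.
  by rewrite mulf_eq0 (negbTE a0).
have [xy|xy] := eqVneq (B x y) (- Q x).
  apply: (tr (x + y) (-1)); rewrite ?oppr_eq0 ?oner_eq0 //.
    by rewrite quadD Qyx xy addrK.
  rewrite reflectionE quadD Qyx xy addrK bilDr bilxx xy F3_addrr opprK.
  rewrite F3_sqr //.
  by rewrite scale1r opprD addrA subrr sub0r scaleN1r.
apply: (tr (x - y) 1); rewrite ?oner_eq0 //.
  by rewrite quadB Qyx F3_addrr subr_eq0 eq_sym.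
rewrite reflectionE quadB Qyx F3_addrr bilDr bilNr bilxx F3_sqr;
  last by rewrite subr_eq0 eq_sym.
by rewrite !scale1r opprB addrCA subrr addr0.
Qed.

(* [x] and [y] span a degenerate plane, with radical spanned by [r]. *)
Lemma card_level_pair x y : Q x != 0 -> plus_vector x -> Q y = Q x ->
  B x y != 0 -> y != x -> x + y != 0 ->
  (#|level (orthm (x + y)%MS) (Q x)| * 3 = 3 ^ (2 * m - 1) - 3 ^ m)%N.
Proof.
move=> Qx [W0 [tsW0 rW0 W0x]] Qyx Bxy yx xy0.
have [r [Qr Bxr ryE]] : exists r, [/\ Q r = 0, B x r = 0 &
    exists a b, y = a *: x + b *: r].
  (* [B x y] is [Q x] or [- Q x]; accordingly the sum or the difference of [x] and [y] is singular
     and orthogonal to [x]. *)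
  have [Bxy1|Bxy1] := eqVneq (B x y) (- Q x).
    exists (x - y); split; first by rewrite quadB Qyx Bxy1 F3_addrr subrr.
      by rewrite bilDr bilNr bilxx Bxy1 subrr.
    by exists 1, (-1); rewrite scale1r scaleN1r opprB addrC subrK.
  have Bxy2 : B x y = Q x.
    have nQx : - Q x != 0 by rewrite oppr_eq0.
    by rewrite -[RHS]opprK; apply: F3_eq_opp; rewrite // eq_sym.
  exists (x + y); split; first by rewrite quadD Qyx Bxy2 F3_addrr addNr.
    by rewrite bilDr bilxx Bxy2 addNr.
  by exists (-1), 1; rewrite scale1r scaleN1r addKr.
have rx : (r <= orthm x)%MS by rewrite orthm_rV bilC Bxr.
(* Choosing [W] through [r] makes it orthogonal to [r] as well as to [x], hence to [y]. *)
have [W [tsW rW Wx rinW]] := ts_through Qx tsW0 rW0 W0x Qr rx.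
rewrite (card_level_perp Qx tsW rW Wx) //; last 2 first.
- apply/rV_subP => w wW; rewrite orthm_adds (submx_trans wW Wx) /=.
  have [a [b ->]] := ryE; rewrite orthm_rV bilDr !bilZr.
  have /orthmP/(_ x (submx_refl _)) -> := submx_trans wW Wx.
  have /orthmP/(_ r rinW) -> := submx_trans wW (ts_orthm tsW).
  by rewrite !mulr0 addr0.
- by apply/rV_subP => w; rewrite orthm_adds => /andP [].
rewrite rank_orthm rank_adds_rV; last first.
  apply/negP => /sub_rVP [a yE]; case: (F3_cases a) yE => -> yE.
  - by move: Qx; rewrite -Qyx yE scale0r quad0 eqxx.
  - by move: yx; rewrite yE scale1r eqxx.
  - by move: xy0; rewrite yE scaleN1r subrr eqxx.
rewrite rank_rV; have -> : x != 0 by apply: contra Qx => /eqP ->; rewrite quad0.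
by congr (3 ^ _ - _)%N; lia.
Qed.

Lemma card_level_orthm x : Q x != 0 -> plus_vector x ->
  (#|level (orthm x) (Q x)| * 3 = 3 ^ (2 * m) - 3 ^ m)%N.
Proof.
move=> Qx [W [tsW rW Wx]]; rewrite (card_level_perp Qx tsW rW Wx) //.
rewrite rank_orthm rank_rV; have -> : x != 0 by apply: contra Qx => /eqP ->;
  rewrite quad0.
by congr (3 ^ _ - _)%N; lia.
Qed.

(** * The bound on cliques *)

(** The condition on sums keeps a vector and its negative from both lying in [T]. The bound comes
    from the first two moments of [nb], the number of members of [T] orthogonal to a given
    vector. *)
Lemma clique_leq (T : {set 'rV[F]_n}) x0 :
    (0 < m)%N -> Q x0 != 0 -> plus_vector x0 ->
    {in T, forall x, Q x = Q x0} -> {in T &, forall x y, B x y != 0} ->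
    {in T &, forall x y, x + y != 0} ->
  (#|T| <= 3 ^ m)%N.
Proof.
move=> m0 Qx0 plus0 QT BT NT.
set E := level 1%:M (Q x0); pose nb y := (\sum_(x in T) (B x y == 0%R))%N.
set k := #|level (orthm x0) (Q x0)|.
set l := ((3 ^ (2 * m - 1) - 3 ^ m) %/ 3)%N.
have plusT x : x \in T -> plus_vector x.
  by move=> xT; apply: plus_vector_transfer (QT _ xT) _.
have kT x : x \in T -> (\sum_(y in E) (B x y == 0%R) = k)%N.
  move=> xT; rewrite sum_bool_card; apply/eqP;
    rewrite -(eqn_pmul2r (m := 3)) //.
  have <- : level (orthm x) (Q x) = [set y in E | B x y == 0].
    by apply/setP => y; rewrite !inE submx1 (QT _ xT) orthm_rV bilC andbC.
  by rewrite /k !card_level_orthm // ?QT //; apply: plusT.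
have lT x y : x \in T -> y \in T -> y != x ->
    (\sum_(z in E) ((B x z == 0%R) * (B y z == 0%R)) = l)%N.
  move=> xT yT yx; under eq_bigr do rewrite mulnb.
  have Qx : Q x != 0 by rewrite QT.
  have Qyx : Q y = Q x by rewrite !QT.
  rewrite sum_bool_card /l.
  rewrite -(card_level_pair Qx (plusT _ xT) Qyx (BT _ _ xT yT) yx) ?NT // mulnK //.
  apply: eq_card => z; rewrite !inE submx1 (QT _ xT) orthm_adds !orthm_rV.
  by rewrite (bilC x) (bilC y) andbC.
have S1 : (\sum_(y in E) nb y = #|T| * k)%N.
  by rewrite exchange_big (eq_bigr _ kT) sum_nat_const.
(* In the expanded square, each diagonal pair contributes [k] and each of the other pairs
   contributes [l]. *)
have S2 : (\sum_(y in E) nb y ^ 2 = #|T| * (k + (#|T| - 1) * l))%N.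
  under eq_bigr => y _ do rewrite -mulnn big_distrlr /=.
  rewrite exchange_big -sum_nat_const; apply: eq_bigr => x xT.
  rewrite exchange_big (bigD1 x) //=; congr (_ + _)%N.
    by rewrite -(kT x xT); apply: eq_bigr => y _; case: (_ == 0).
  rewrite (eq_bigr (fun _ => l)) => [|y /andP [yT yx]]; last exact: lT.
  rewrite sum_nat_const (cardD1 x T) xT addKn; congr (_ * _)%N.
  by apply: eq_card => y; rewrite !inE andbC.
(* Cauchy-Schwarz is sharp only off [N], where [nb] vanishes. *)
set N := T :|: [set - x | x in T].
have cardN : #|N| = (2 * #|T|)%N.
  rewrite cardsU disjoint_setI0 ?cards0 ?subn0; last first.
    rewrite disjoints_subset; apply/subsetP => x xT; rewrite inE.
    by apply/imsetP => -[y yT xy]; have := NT _ _ xT yT; rewrite xy addNr eqxx.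
  by rewrite card_imset ?mul2n ?addnn //; apply: oppr_inj.
have NE : N \subset E.
  apply/subsetP => y /setUP yN; rewrite inE submx1 /=.
  case: yN => [yT|/imsetP [x xT ->]]; first by rewrite QT.
  by rewrite quadN QT.
have nbN y : y \in N -> nb y = 0%N.
  move=> yN; apply: big1 => x xT; apply/eqP; rewrite eqb0; move: yN.
  case/setUP => [yT|/imsetP [z zT ->]]; first exact: BT.
  by rewrite bilNr oppr_eq0 BT.
have restrict (f : nat -> nat) : f 0%N = 0%N ->
    (\sum_(y in E :\: N) f (nb y) = \sum_(y in E) f (nb y))%N.
  move=> f0; rewrite [RHS](big_setID N) /= [X in (X + _)%N]big1 ?add0n // => y.
  by case/setIP => _ /nbN ->.
have := leq_sqr_sum (E :\: N) nb.
rewrite (restrict (fun i => i)) // (restrict (fun i => i ^ 2)%N) // S1 S2.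
rewrite cardsD (setIidPr NE) cardN.
have := subset_leq_card NE; rewrite cardN.
have [W [tsW rW Wx]] := plus0; rewrite (card_level_plus Qx0 tsW rW Wx).
have := card_level_orthm Qx0 plus0; rewrite -/k.
have l3 : (l * 3 = 3 ^ (2 * m - 1) - 3 ^ m)%N.
  rewrite /l divnK // dvdn_sub // -(prednK m0) ?expnS ?dvdn_mulr //.
  by rewrite (_ : (_ - 1) = (2 * m.-1).+1)%N ?expnS ?dvdn_mulr //; lia.
move: l3; move: #|T| (k) (l) => w k' l'.
(* With [q = 3^p] and [m = p + 1], the clique bound is [3 q] and the counts take the form expected
   by [clique_arith]. *)
have [p mE] : exists p, m = p.+1 by exists m.-1; rewrite prednK.
rewrite mE (_ : (2 * p.+1 - 1) = p.+1 + p)%N; last lia.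
rewrite (_ : (2 * p.+1) = p.+1 + p.+1)%N; last lia.
rewrite !expnD !(expnS 3); move: (expn_gt0 3 p); move: (3 ^ p)%N => q /= q0.
exact: clique_arith.
Qed.

(** * Orthogonal frames *)

(** Pairing a linear relation with one member isolates its coefficient, so the members are linearly
    independent. *)
Lemma orthogonal_frame_leq (T : {set 'rV[F]_n}) :
    {in T, forall x, Q x != 0} -> {in T &, forall x y, x != y -> B x y = 0} ->
  (#|T| <= n)%N.
Proof.
move=> QT BT; pose M : 'M[F]_(#|T|, n) := \matrix_(i < #|T|) enum_val i.
suff /eqP <- : row_free M by apply: rank_leq_col.
apply: inj_row_free => v vM; apply/rowP => i; rewrite mxE.
have xT := enum_valP i; have : B (v *m M) (enum_val i) = 0 by rewrite vM bil0l.
rewrite mulmx_sum_row bil_suml (bigD1 i) //= big1 => [|j ji].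
  rewrite addr0 bilZl rowK bilxx => /eqP.
  by rewrite mulf_eq0 oppr_eq0 (negbTE (QT _ xT)) orbF => /eqP.
rewrite bilZl rowK BT ?mulr0 ?enum_valP //.
by apply: contra ji => /eqP/enum_val_inj ->.
Qed.

(** As [A] is its own double complement, some vector of its complement is not orthogonal to [w].
    Scaling makes the product 1, and subtracting a multiple of [w] makes the vector singular. *)
Lemma hyperbolic_partner k (A : 'M_(k, n)) w :
    Q w = 0 -> (w <= orthm A)%MS -> ~~ (w <= A)%MS ->
  exists y, [/\ (y <= orthm A)%MS, B w y = 1 & Q y = 0].
Proof.
move=> Qw wA wnA.
have [y yA yw] : exists2 y : 'rV_n, (y <= orthm A)%MS & ~~ (y <= orthm w)%MS.
  apply: not_submx_exists; apply: contra wnA => Aw.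
  by rewrite -(orthmK A) orthmC.
set b := B w y; have b0 : b != 0 by rewrite /b bilC -orthm_rV.
pose z := b *: y; have wz : B w z = 1 by rewrite bilZr F3_sqr.
exists (z - Q z *: w); split.
- by rewrite addmx_sub ?eqmx_opp ?scalemx_sub.
- by rewrite bilDr bilNr bilZr bilxx Qw oppr0 mulr0 subr0.
- by rewrite quadB quadZ Qw mulr0 addr0 bilZr bilC wz mulr1 subrr.
Qed.

(* Two orthogonal hyperbolic planes are spanned by orthogonal vectors
   [a], [b], [c], [d] with values [e], [- e], [e], [- e] of [Q], where
   [e = Q x], and [Q (b + d) = Q (b - d) = - e - e = e]. *)
Lemma orthogonal_frame5 x : m = 2%N -> Q x != 0 -> plus_vector x ->
  exists T : {set 'rV[F]_n}, [/\ #|T| = 5%N, {in T, forall y, Q y = Q x} &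
    {in T &, forall y z, y != z -> B y z = 0}].
Proof.
move=> m2 Qx [W [tsW rW Wx]].
have W_x w : (w <= W)%MS -> B w x = 0.
  by move=> wW; apply/eqP; rewrite -orthm_rV (submx_trans wW).
have [w1 w1W w1_0] : exists2 w : 'rV_n, (w <= W)%MS & w != 0.
  by apply/rowV0Pn; rewrite -mxrank_eq0 rW m2.
have w1nx : ~~ (w1 <= x)%MS.
  apply: contra w1_0 => /sub_rVP [a w1E]; have := tsW _ w1W;
    rewrite w1E quadZ => /eqP.
  by rewrite !mulf_eq0 (negbTE Qx) orbF orbb => /eqP ->; rewrite scale0r.
have [|y1 [y1x w1y1 Qy1]] := hyperbolic_partner (tsW _ w1W) _ w1nx.
  by rewrite orthm_rV W_x.
(* [W] is a plane, and one linear condition leaves at least a line in it. *)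
have [w2 w2W' w2_0] : exists2 w : 'rV_n, (w <= W :&: orthm y1)%MS & w != 0.
  apply/rowV0Pn; rewrite -mxrank_eq0; have := mxrank_sum_cap W (orthm y1).
  have := rank_leq_col (W + orthm y1)%MS; have := rank_leq_row y1.
  by rewrite rank_orthm rW; lia.
move: w2W'; rewrite sub_capmx orthm_rV => /andP [w2W /eqP w2y1].
have w2w1 : B w2 w1 = 0 by move/orthmP: (submx_trans w2W (ts_orthm tsW)) => ->.
have w2x := W_x _ w2W; have w1x := W_x _ w1W.
have y1x0 : B y1 x = 0 by apply/eqP; rewrite -orthm_rV.
have w2A : (w2 <= orthm (x + w1 + y1)%MS)%MS.
  by rewrite !orthm_adds !orthm_rV w2x w2w1 w2y1 eqxx.
(* Pairing a supposed relation with [x], [w1] and [y1] kills the coefficients of [x], [y1] and [w1]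
   respectively. *)
have w2nA : ~~ (w2 <= x + w1 + y1)%MS.
  apply: contra w2_0 => /sub_addsmxP [[u c] /= w2E].
  have /sub_addsmxP [[a b] /= uE] := submxMl u (x + w1)%MS.
  have [/sub_rVP [a' aE] /sub_rVP [b' bE]] := (submxMl a x, submxMl b w1).
  have /sub_rVP [c' cE] := submxMl c y1.
  move: w2E; rewrite uE aE bE cE => w2E.
  have := w2x; rewrite w2E !bilDl !bilZl w1x y1x0 bilxx !mulr0 !addr0 => /eqP.
  rewrite mulf_eq0 oppr_eq0 (negbTE Qx) orbF => /eqP a0.
  have := w2w1; rewrite w2E !bilDl !bilZl (bilC x) w1x (bilC y1) w1y1 bilxx
    (tsW _ w1W).
  rewrite oppr0 !mulr0 !add0r mulr1 => c0.
  have := w2y1; rewrite w2E !bilDl !bilZl (bilC x) y1x0 w1y1 bilxx Qy1.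
  by rewrite oppr0 !mulr0 add0r addr0 mulr1 => b0;
    rewrite a0 b0 c0 !scale0r !addr0.
have [y2 [y2A w2y2 Qy2]] := hyperbolic_partner (tsW _ w2W) w2A w2nA.
move: y2A; rewrite !orthm_adds !orthm_rV =>
  /andP [/andP [/eqP y2x /eqP y2w1] /eqP y2y1].
have [Qw1 Qw2] := (tsW _ w1W, tsW _ w2W).
have BB := (w1x, y1x0, w2x, y2x, w2w1, y2w1, w2y1, y2y1, w1y1, w2y2,
  (bilC x w1), (bilC x y1), (bilC x w2), (bilC x y2), (bilC w1 w2),
  (bilC w1 y2), (bilC y1 w2), (bilC y1 y2), (bilC y1 w1), (bilC y2 w2)).
set e := Q x.
pose a := w1 + e *: y1; pose b := w1 - e *: y1.
pose c := w2 + e *: y2; pose d := w2 - e *: y2.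
pose s := [:: x; a; c; b + d; b - d].
have [w1w1 y1y1 w2w2 y2y2] :
  [/\ B w1 w1 = 0, B y1 y1 = 0, B w2 w2 = 0 & B y2 y2 = 0].
  by rewrite !bilxx Qw1 Qy1 Qw2 Qy2 oppr0.
pose simp := (BB, w1w1, y1y1, w2w2, y2y2, mulr0, mulr1, mul0r, add0r, addr0,
  oppr0).
have [Qa Qb Qc Qd] : [/\ Q a = e, Q b = - e, Q c = e & Q d = - e].
  by rewrite !quadB !quadD !quadZ !bilZr Qw1 Qy1 Qw2 Qy2 !simp.
have [xa xb xc xd] : [/\ B x a = 0, B x b = 0, B x c = 0 & B x d = 0].
  by rewrite !bilDr !bilNr !bilZr !simp.
have [ac ad cb bd] : [/\ B a c = 0, B a d = 0, B c b = 0 & B b d = 0].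
  by rewrite !bilDr !bilDl !bilNr !bilNl !bilZr !bilZl !simp.
have [ab cd] : B a b = 0 /\ B c d = 0.
  by rewrite !bilDr !bilDl !bilNr !bilZr !bilZl !simp subrr ?oppr0.
clearbody a b c d.
have Qs : {in s, forall y, Q y = e}.
  move=> y; rewrite !inE => /or4P [/eqP->|/eqP->|/eqP->|/orP[]/eqP->] //.
    by rewrite quadD Qb Qd bd addr0 F3_addrr opprK.
  by rewrite quadB Qb Qd bd subr0 F3_addrr opprK.
(* [b + d] and [b - d] are orthogonal since [b] and [d] are orthogonal with the same value of
   [Q]. *)
have Bs : pairwise (fun y z => B y z == 0) s.
  rewrite /= xa xc ac (bilDr x) (bilDr x) (bilDr a) (bilDr a) (bilDr c)
    (bilDr c).
  rewrite !bilNr xb xd ab ad cb cd !simp !eqxx /= andbT.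
  by rewrite bilDl !bilDr !bilNr !bilxx (bilC d b) bd Qb Qd !simp !opprK subrr
    eqxx.
(* A repeated vector would be orthogonal to itself, whereas [B y y = - e]. *)
have us : uniq s.
  rewrite uniq_pairwise.
  apply: (sub_in_pairwise (P := [in s]) _ _ Bs) => [y z ys zs /=|];
    last exact/allP.
  by apply: contraTneq => ->; rewrite bilxx oppr_eq0 Qs.
exists [set y in s]; split.
- by rewrite cardsE (card_uniqP us).
- by move=> y; rewrite in_set; apply: Qs.
move=> y z; rewrite !in_set => ys zs yz.
have Bij i j : (i < j < size s)%N -> B (nth 0 s i) (nth 0 s j) = 0.
  case/andP => ij js; apply/eqP; move/(pairwiseP 0): Bs; apply => //.
  exact: ltn_trans js.
have [lt|lt|eq_i] := ltngtP (index y s) (index z s).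
- by rewrite -(nth_index 0 ys) -(nth_index 0 zs) Bij // lt index_mem.
- by rewrite bilC -(nth_index 0 ys) -(nth_index 0 zs) Bij // lt index_mem.
- by case/eqP: yz; rewrite -(nth_index 0 ys) eq_i nth_index.
Qed.

(** * From vectors to an abstract graph with a representative vector for each vertex *)

Section Representatives.

Variables (G : sgraph) (rep : vertex G -> 'rV[F]_n) (x0 : 'rV[F]_n).
Hypotheses (Qx0 : Q x0 != 0) (plus_x0 : plus_vector x0) (m_ge2 : (2 <= m)%N).
Hypothesis repQ : forall X, Q (rep X) = Q x0.
Hypothesis rep_inj : forall X Y a, rep X = a *: rep Y -> X = Y.
Hypothesis rep_surj : forall y, Q y = Q x0 -> exists X a, rep X = a *: y.
Hypothesis adjE : forall X Y, adj X Y = (X != Y) && (B (rep X) (rep Y) != 0).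

Lemma rep_injective : injective rep.
Proof. by move=> X Y XY; apply: (@rep_inj X Y 1); rewrite scale1r. Qed.

Lemma rep_bilxx X : B (rep X) (rep X) != 0.
Proof. by rewrite bilxx repQ oppr_eq0. Qed.

Lemma rep_addr_neq0 X Y : rep X + rep Y != 0.
Proof.
apply/eqP => /eqP; rewrite addr_eq0 => /eqP XY.
have XeqY : X = Y by apply: (@rep_inj X Y (-1)); rewrite scaleN1r.
have := F3_addrr_eq0 (B (rep Y) (rep Y)); rewrite (negbTE (rep_bilxx Y)).
by rewrite -bilDr -{2}XeqY XY addNr bil0r eqxx.
Qed.

(** Each vertex accounts for exactly two vectors of the level of [x0], its representative and the
    negative. *)
Lemma card_vertices : (#|vertex G| * 2 = 3 ^ m * (3 ^ m + 1))%N.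
Proof.
have [W [tsW rW Wx]] := plus_x0; rewrite -(card_level_plus Qx0 tsW rW Wx).
set R := [set rep X | X in vertex G].
have -> : level 1%:M (Q x0) = R :|: [set - x | x in R].
  apply/setP => y; rewrite inE submx1 /=; apply/eqP/setUP => [Qy|].
    have [X [a Xy]] := rep_surj Qy; have := repQ X; rewrite Xy quadZ Qy.
    case: (F3_cases a) Xy => ->; rewrite ?scale1r ?scaleN1r => Xy.
    - by rewrite mulr0 mul0r => Qx; case/eqP: Qx0.
    - by left; rewrite -Xy imset_f.
    - by right; rewrite -[y]opprK -Xy !imset_f.
  case=> [/imsetP [X _ ->]|/imsetP [_ /imsetP [X _ ->] ->]]; first exact: repQ.
  by rewrite quadN repQ.
rewrite cardsU disjoint_setI0 ?cards0 ?subn0; last first.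
  rewrite disjoints_subset; apply/subsetP => _ /imsetP [X _ ->]; rewrite inE.
  apply/imsetP => -[_ /imsetP [Y _ ->]] XY.
  by have := rep_addr_neq0 X Y; rewrite XY addNr eqxx.
by rewrite (card_imset _ oppr_inj) (card_imset _ rep_injective) muln2 addnn.
Qed.

Lemma clique_number_le : (clique_number G <= 3 ^ m)%N.
Proof.
apply/bigmax_leqP => A /forall_inP cliqueA.
rewrite -(card_imset _ rep_injective); apply: (clique_leq _ Qx0 plus_x0).
- exact: ltnW.
- by move=> _ /imsetP [X _ ->].
- move=> _ _ /imsetP [X XA ->] /imsetP [Y YA ->].
  have [->|XY] := eqVneq X Y; first exact: rep_bilxx.
  have /forall_inP/(_ Y YA)/implyP/(_ XY) := cliqueA X XA.
  by rewrite adjE => /andP [].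
- by move=> _ _ /imsetP [X _ ->] /imsetP [Y _ ->]; apply: rep_addr_neq0.
Qed.

Lemma coclique_number_le : (coclique_number G <= 2 * m + 1)%N.
Proof.
rewrite -n_odd; apply/bigmax_leqP => A /forall_inP cocliqueA.
rewrite -(card_imset _ rep_injective); apply: orthogonal_frame_leq.
  by move=> _ /imsetP [X _ ->]; rewrite repQ.
move=> _ _ /imsetP [X XA ->] /imsetP [Y YA ->] XY.
have /forall_inP/(_ Y YA) := cocliqueA X XA; rewrite adjE.
have [XeqY|_] := eqVneq X Y; first by rewrite XeqY eqxx in XY.
by rewrite /= negbK => /eqP.
Qed.

Lemma vertex_of : exists f : 'rV[F]_n -> vertex G,
  forall y, Q y = Q x0 -> exists2 a, a != 0 & rep (f y) = a *: y.
Proof.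
(* The vertex of [x0] is the default value at vectors outside the level. *)
have [X0 _] := rep_surj (erefl (Q x0)).
apply: (@fin_all_exists _ (fun=> vertex G)
  (fun y X => Q y = Q x0 -> exists2 a, a != 0 & rep X = a *: y)) => y.
have [Qy|] := eqVneq (Q y) (Q x0); last by move/eqP=> Qy; exists X0.
have [X [a Xy]] := rep_surj Qy; exists X => _; exists a => //.
by apply: contraNneq Qx0 => a0; rewrite -(repQ X) Xy a0 scale0r quad0.
Qed.

Lemma clique_number_ge : (3 ^ m <= clique_number G)%N.
Proof.
have [W [tsW rW Wx]] := plus_x0; have [f fE] := vertex_of.
have Wx0 w : (w <= W)%MS -> B x0 w = 0.
  by move=> wW; rewrite bilC; apply/eqP; rewrite -orthm_rV (submx_trans wW).
have Qw w : w \in rowg W -> Q (x0 + w) = Q x0.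
  by rewrite inE => wW; rewrite quadD (tsW w) // Wx0 // !addr0.
have Bx0w w : w \in rowg W -> B x0 (x0 + w) = - Q x0.
  by rewrite inE => wW; rewrite bilDr bilxx Wx0 // addr0.
have f_inj : {in rowg W &, injective (fun w => f (x0 + w))}.
  move=> w w' wW w'W ff.
  have [a a0 aE] := fE _ (Qw _ wW); have [b b0 bE] := fE _ (Qw _ w'W).
  have ab : a *: (x0 + w) = b *: (x0 + w') by rewrite -aE ff bE.
  (* Both [x0 + w] and [x0 + w'] have product [- Q x0] with [x0], so the two scalars agree. *)
  have : B x0 (a *: (x0 + w)) = B x0 (b *: (x0 + w')) by rewrite ab.
  rewrite !bilZr !Bx0w // => /mulIf; rewrite oppr_eq0 => /(_ Qx0) aeqb.
  by move: ab; rewrite aeqb => /(scalerI b0)/addrI.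
have <- : #|[set f (x0 + w) | w in rowg W]| = (3 ^ m)%N.
  by rewrite (card_in_imset f_inj) card_rowg card_F3 rW.
apply: leq_bigmax_cond; apply/forall_inP => _ /imsetP [w wW ->].
apply/forall_inP => _ /imsetP [w' w'W ->]; apply/implyP => ww'.
have [a a0 aE] := fE _ (Qw _ wW); have [b b0 bE] := fE _ (Qw _ w'W).
rewrite adjE ww' aE bE bilZl bilZr bilDl Bx0w //.
move: wW w'W; rewrite !inE => wW w'W.
have /orthmP/(_ _ w'W) ww0 := submx_trans wW (ts_orthm tsW).
by rewrite bilDr ww0 bilC Wx0 // !addr0 !mulf_neq0 ?oppr_eq0.
Qed.

Lemma coclique_number_ge5 : m = 2%N -> (5 <= coclique_number G)%N.
Proof.
move=> m2; have [T [T5 QT BT]] := orthogonal_frame5 m2 Qx0 plus_x0.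
have [f fE] := vertex_of.
have f_inj : {in T &, injective f}.
  move=> u v uT vT fuv; apply/eqP/negPn/negP => uv.
  have [a a0 aE] := fE _ (QT _ uT); have [b b0 bE] := fE _ (QT _ vT).
  by have := rep_bilxx (f u); rewrite {2}fuv aE bE bilZl bilZr BT // !mulr0
    eqxx.
rewrite -T5 -(card_in_imset f_inj); apply: leq_bigmax_cond.
apply/forall_inP => _ /imsetP [u uT ->]; apply/forall_inP =>
  _ /imsetP [v vT ->].
rewrite adjE; have [-> | uv] := eqVneq u v; first by rewrite eqxx.
have [a a0 aE] := fE _ (QT _ uT); have [b b0 bE] := fE _ (QT _ vT).
by rewrite aE bE bilZl bilZr BT // !mulr0 eqxx andbF.
Qed.

Lemma nonseparating_iff : ~~ separating G <-> m = 2%N.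
Proof.
rewrite /separating -leqNgt; split=> [|m2].
  have [//|m_neq2] := eqVneq m 2%N; have : (3 <= m)%N by lia.
  move=> m3 /leq_trans/(_ (leq_mul clique_number_le coclique_number_le)).
  (* This is [2 (2m + 1) < 3^m + 1], by induction from [14 < 28] at [m = 3]. *)
  have : (4 * m + 2 < 3 ^ m + 1)%N.
    elim: m m3 => // k IH; rewrite leq_eqVlt => /orP [/eqP <- //|/IH].
    by rewrite expnS; lia.
  have := card_vertices; have := expn_gt0 3 m; nia.
have := leq_mul clique_number_ge (coclique_number_ge5 m2).
apply: leq_trans; have := card_vertices; rewrite m2; lia.
Qed.

End Representatives.

(** The radical of [x]^perp lies in the double complement, the line of [x], and this line meets
    [x]^perp trivially. *)
Lemma orthm_nondegenerate x y : Q x != 0 -> (y <= orthm x)%MS ->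
  (forall z, (z <= orthm x)%MS -> B y z = 0) -> y = 0.
Proof.
move=> Qx yx /orthmP; rewrite orthmK => /sub_rVP [a yE].
move: yx; rewrite yE orthm_rV bilZl bilxx mulf_eq0 oppr_eq0 (negbTE Qx) orbF.
by move/eqP->; rewrite scale0r.
Qed.

(** No totally singular subspace exceeds dimension [m], so the maximum is [m] as soon as it is
    attained. The predicate [p] stands for the boolean condition in [witt_index]. *)
Lemma max_rank_tsP x (p : pred 'M[F]_n) : Q x != 0 ->
    (forall W, p W <-> ts W /\ (W <= orthm x)%MS) ->
  (\max_(W | p W) \rank W == m)%N <-> plus_vector x.
Proof.
move=> Qx pP; have p_gt0 : (0 < #|p|)%N.
  apply/card_gt0P; exists 0; apply/pP; split; last exact: sub0mx.
  by move=> y; rewrite submx0 => /eqP ->; apply: quad0.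
split=> [/eqP maxE|[W [tsW rW Wx]]].
  have [W /pP [tsW Wx] WE] := eq_bigmax_cond (fun W => \rank W) p_gt0.
  by exists W; split; rewrite // -WE.
have pW : p W by apply/pP.
rewrite eqn_leq -{2}rW leq_bigmax_cond // andbT.
by apply/bigmax_leqP => W' /pP [/rank_ts]; lia.
Qed.

End OverF3.

(** * Specialization to ['F_3] and to the graph [NOplus] *)

Section QuadraticFormsOverF3.

Local Open Scope ring_scope.

Variables (n m : nat) (Q : 'rV['F_3]_n -> 'F_3).
Hypotheses (Qquad : quadratic_form Q) (Qnd : quad_nondegenerate Q).
Hypothesis n_odd : n = (2 * m + 1)%N.

Lemma Fp3_cases (a : 'F_3) : [\/ a = 0, a = 1 | a = -1].
Proof.
by case: a => [[|[|[|k]]] // lt_k3];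
  [constructor 1 | constructor 2 | constructor 3]; exact/val_inj.
Qed.

Lemma Fp3_two : 1 + 1 = -1 :> 'F_3. Proof. exact/val_inj. Qed.

Let QZ := proj1 Qquad.
Let Blin := proj2 Qquad.

Lemma polar_nondegenerate x : (forall y, polar Q x y = 0) -> x = 0.
Proof.
move=> Bx; apply/eqP; move/forallP/(_ x): Qnd; rewrite submx1 /= => /implyP.
apply.
by apply/forallP => y; rewrite Bx eqxx implybT.
Qed.

Lemma perp_orthm x : (perp Q x :=: orthm Q x)%MS.
Proof.
apply/eqmxP/rV_eqP => y; rewrite (mem_perp _ _ Qquad).
by rewrite (orthm_rV Blin) -[polar Q x y]/(bil Q x y) bilC.
Qed.

(** [x]^perp is nondegenerate of dimension [2 m], so plus type reduces to Witt index [m]. *)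
Lemma plus_typeP x : Q x != 0 -> plus_type Q (perp Q x) <-> plus_vector Q m x.
Proof.
move=> Qx; have Qnd' := polar_nondegenerate.
rewrite -(max_rank_tsP QZ Blin Qnd' n_odd
  (p := fun W => (W <= perp Q x)%MS && totally_singular Q W) Qx); last first.
  move=> W; rewrite perp_orthm; split=> [/andP [Wx /forallP tsW]|[tsW ->]].
    by split=> // y yW; apply/eqP; have /implyP := tsW y; apply.
  by apply/forallP => y; apply/implyP => /tsW ->.
rewrite /plus_type perp_orthm (rank_orthm Blin Qnd') rank_rV.
have -> /= : x != 0 by apply: contra Qx => /eqP ->; rewrite (quad0 QZ).
have -> : nondegenerate_on Q (perp Q x).
  apply/forallP => y; apply/implyP; rewrite perp_orthm => yx.
  apply/implyP => /forallP By; apply/eqP.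
  apply: (orthm_nondegenerate Fp3_two QZ Blin Qnd' Qx yx) => z zx.
  by apply/eqP; have := By z; rewrite perp_orthm zx.
rewrite [X in (X - 1)%N]n_odd addnK eqn_pmul2l //= eq_sym; exact: iff_refl.
Qed.

Lemma NOplus_separating : (2 <= m)%N -> ~~ separating (NOplus Q) <-> m = 2%N.
Proof.
move=> m_ge2; have Qnd' := polar_nondegenerate.
have [x0 Qx0 plus_x0] := plus_vector_exists Fp3_cases Fp3_two QZ Blin Qnd'
  n_odd.
have vertexP (X : vertex (NOplus Q)) : exists x,
  [&& val X == <<x>>%MS, Q x != 0 & plus_type Q (perp Q x)].
- exact/existsP/(valP X).
pose rep X := xchoose (vertexP X).
have repE X : val X = <<rep X>>%MS
  by have /and3P [/eqP] := xchooseP (vertexP X).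
have repQ X : Q (rep X) = Q x0.
  have /and3P [_ Qx /(plus_typeP Qx)] := xchooseP (vertexP X).
  exact: (plus_vector_quad Fp3_cases Fp3_two QZ Blin Qnd' n_odd Qx0 plus_x0 Qx).
apply: (nonseparating_iff Fp3_cases Fp3_two QZ Blin Qnd' n_odd
  (G := NOplus Q) (rep := rep) Qx0 plus_x0 m_ge2 repQ).
- move=> X Y a XY; apply/val_inj; rewrite !repE XY; apply/eq_genmx/eqmx_scale.
  by apply: contraNneq Qx0 => a0; rewrite -(repQ X) XY a0 scale0r (quad0 QZ).
- move=> y Qy; have Qy0 : Q y != 0 by rewrite Qy.
  have yP : NOplus_point Q <<y>>%MS.
    apply/existsP; exists y; rewrite eqxx Qy0; apply/plus_typeP => //.
    exact: (plus_vector_transfer Fp3_cases Fp3_two QZ Blin Qx0 Qy plus_x0).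
  (* The chosen representative of the point of [y] need not be [y] itself, only a multiple of it. *)
  pose X : vertex (NOplus Q) := Sub <<y>>%MS yP.
  have : (rep X <= val X)%MS by rewrite repE genmxE.
  by rewrite genmxE => /sub_rVP [a Xy]; exists X, a.
- by move=> X Y; apply: NOplus_adjE.
Qed.

End QuadraticFormsOverF3.

Theorem theorem3p2 (m : nat) (hm : 2 <= m)
    (Q : 'rV['F_3]_(2 * m + 1) -> 'F_3)
    (Qquad : quadratic_form Q) (Qnd : quad_nondegenerate Q) :
  ~~ separating (NOplus Q) <-> m = 2.
Proof. exact: NOplus_separating. Qed.
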